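(* Let $A=\bigoplus_{n\geq 0}A_n$ be a tower of algebras over $\mathbb{C}$ (in the sense defined in the context) such that its associated Grothendieck groups $G(A)$ and $K(A)$, with the induction product, restriction coproduct and pairing described in the context, form a pair of graded dual Hopf algebras. Then for every $n\geq 0$, $$\dim(A_n)=r^n\, n!,\qquad\text{where } r=\dim(A_1).$$
   Context: A graded algebra $A=\bigoplus_{n\ge0}A_n$ over $\mathbb{C}$ with (external) multiplication $\rho$ is a tower of algebras if: (1) each $A_n$ is a finite-dimensional algebra with its own (internal) multiplication and unit $1_n$, and $A_0\cong\mathbb{C}$; (2) each external multiplication $\rho_{m,n}:A_m\otimes A_n\to A_{m+n}$ is an injective algebra homomorphism sending $1_m\otimes 1_n$ to $1_{m+n}$; (3) $A_{m+n}$ is a two-sided projective $A_m\otimes A_n$-module via $a\cdot(b\otimes c)=a\rho_{m,n}(b\otimes c)$ and $(b\otimes c)\cdot a=\rho_{m,n}(b\otimes c)a$. For a finite-dimensional algebra $B$, $G_0(B)$ is the Grothendieck group of finitely generated left $B$-modules (free on the classes $[V]$ of the simple modules) and $K_0(B)$ is the Grothendieck group of finitely generated projective left $B$-modules (free on the classes $[P]$ of the indecomposable projectives, i.e. projective covers of the simples). Set $G(A)=\bigoplus_{n\ge0}G_0(A_n)$ and $K(A)=\bigoplus_{n\ge0}K_0(A_n)$. On each, define a product by $[M][N]=[\mathrm{Ind}_{A_m\otimes A_n}^{A_{m+n}}M\otimes N]$ for $[M]$ in degree $m$ and $[N]$ in degree $n$ (induction along $\rho_{m,n}$, i.e. $A_{m+n}\otimes_{A_m\otimes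 A_n}(M\otimes N)$), and a coproduct by $\Delta([N])=\sum_{k+l=n}[\mathrm{Res}^{A_{k+l}}_{A_k\otimes A_l}N]$ for $[N]$ in degree $n$ (restriction along $\rho_{k,l}$). The pairing $K(A)\times G(A)\to\mathbb{Z}$ is $\langle [P],[M]\rangle=\dim_{\mathbb{C}}\mathrm{Hom}_{A_n}(P,M)$ if $[P]\in K_0(A_n)$ and $[M]\in G_0(A_n)$, and $0$ if they lie in different degrees. ''Form a pair of graded dual Hopf algebras'' means that with these operations $G(A)$ and $K(A)$ are graded Hopf algebras which are dual to each other under this pairing (product of one is dual to coproduct of the other). *)

(* Defs.v *)
From HB Require Import structures.
From mathcomp Require Import all_boot all_order all_algebra.
From mathcomp Require Import boolp reals.
From mathcomp Require Import complex freeg.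

Set Implicit Arguments.
Unset Strict Implicit.
Unset Printing Implicit Defensive.

Import GRing.Theory.
Import passmx.

Local Open Scope ring_scope.
Local Open Scope quotient_scope.

Section Zspan.
Variables (V : zmodType) (S : V -> Prop).

(* The subgroup of V generated by S. *)
Definition zspan (x : V) : Prop :=
  forall P : V -> Prop, P 0 -> (forall y z, P y -> P z -> P (y - z)) ->
    (forall y, S y -> P y) -> P x.

Definition zspanb : {pred V} := [pred x | `[< zspan x >]].

Lemma zspanb_closed : zmod_closed zspanb.
Proof.
split=> [|x y]; rewrite !inE; first by apply/asboolP => P.
move=> /asboolP Hx /asboolP Hy; apply/asboolP => P P0 PB PS.
exact: PB (Hx P P0 PB PS) (Hy P P0 PB PS).
Qed.

HB.instance Definition _ := GRing.isZmodClosed.Build V zspanb zspanb_closed.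
End Zspan.

Section FreeExtension.
Variables (X : choiceType) (W : zmodType) (f : X -> W).

(* The homomorphism of abelian groups {freeg X} -> W extending f. *)
Definition fgext (D : {freeg X}) : W := fglift (f : X -> zmodule W) D.

Lemma fgext_additive : zmod_morphism fgext.
Proof. exact: (lift_is_additive (f : X -> zmodule W)). Qed.
HB.instance Definition _ :=
  GRing.isZmodMorphism.Build {freeg X} W fgext fgext_additive.

Lemma fgextU x : fgext << x >> = f x.
Proof. by rewrite /fgext liftU scale1r. Qed.
End FreeExtension.

Section Presentation.
Variables (X : choiceType) (S : {freeg X} -> Prop).

(* The abelian group with generators X and relations r = 0 for S r. *)
Definition pres : zmodType := Quotient.quot (zspanb S : zmodClosed {freeg X}).

Definition pres_gen (x : X) : pres := \pi_pres << x >>.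

(* The homomorphism pres -> W sending each generator x to f x; it is
   meaningful only if f respects the relations S. *)
Definition pres_lift (W : zmodType) (f : X -> W) (u : pres) : W :=
  fgext f (repr u).

Section PresLift.
Variables (W : zmodType) (f : X -> W).
Hypothesis fS : forall r, S r -> fgext f r = 0.

Lemma pres_lift_pi D : pres_lift f (\pi_pres D) = fgext f D.
Proof.
apply/eqP; rewrite -subr_eq0 -raddfB; apply/eqP.
have : repr (\pi_pres D) - D \in zspanb S.
  by have := reprK (\pi_pres D); move/eqP; rewrite -Quotient.idealrBE.
rewrite inE => /asboolP /(_ (fun D => fgext f D = 0)); apply=> // [|y z].
  exact: raddf0.
by move=> hy hz; rewrite raddfB /= hy hz subr0.
Qed.

Lemma pres_lift_additive : zmod_morphism (pres_lift f).
Proof.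
move=> u v; rewrite -[u]reprK -[v]reprK -raddfB !pres_lift_pi.
exact: raddfB.
Qed.

Lemma pres_lift_gen x : pres_lift f (pres_gen x) = f x.
Proof. by rewrite pres_lift_pi fgextU. Qed.
End PresLift.
End Presentation.

Section TensorZ.
Variables U V : zmodType.

Variant tens_rel : {freeg (U * V)%type} -> Prop :=
| TensDl u u' v : tens_rel (<< (u + u', v) >> - << (u, v) >> - << (u', v) >>)
| TensDr u v v' : tens_rel (<< (u, v + v') >> - << (u, v) >> - << (u, v') >>).

Definition tens : zmodType := pres tens_rel.

Definition tpure (u : U) (v : V) : tens := pres_gen tens_rel (u, v).

(* The homomorphism induced by a biadditive f. *)
Definition tlift (W : zmodType) (f : U -> V -> W) : tens -> W :=
  pres_lift (fun p => f p.1 p.2).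
End TensorZ.

Definition biadditive (U V W : zmodType) (f : U -> V -> W) : Prop :=
  (forall u, zmod_morphism (f u)) /\ (forall v, zmod_morphism (f^~ v)).

Section TensorZTheory.
Variables (U V W : zmodType) (f : U -> V -> W).
Hypothesis fP : biadditive f.

Lemma tens_relP (r : {freeg (U * V)%type}) : tens_rel r ->
  fgext (fun p => f p.1 p.2) r = 0.
Proof.
have morD (A B : zmodType) (g : A -> B) : zmod_morphism g -> {morph g : x y / x + y}.
  move=> gB x y; have g0 : g 0 = 0 by rewrite -(subrr 0) gB subrr.
  by rewrite -{1}[y]opprK gB -[- y]sub0r gB g0 sub0r opprK.
case: fP => fr fl; case=> *; rewrite !raddfB /= !fgextU /=.
  by rewrite (morD _ _ _ (fl _)) addrAC addrK subrr.
by rewrite (morD _ _ _ (fr _)) addrAC addrK subrr.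
Qed.

Lemma tlift_additive : zmod_morphism (tlift f).
Proof. exact: pres_lift_additive tens_relP. Qed.

Lemma tlift_pure u v : tlift f (tpure u v) = f u v.
Proof. exact: pres_lift_gen tens_relP _. Qed.
End TensorZTheory.

Definition tmap (U V U' V' : zmodType) (f : U -> U') (g : V -> V') :
    tens U V -> tens U' V' :=
  tlift (fun u v => tpure (f u) (g v)).

Definition tassoc (U V W : zmodType) (t : tens (tens U V) W) :
    tens U (tens V W) :=
  tlift (fun s w => tlift (fun u v => tpure u (tpure v w)) s) t.

Section DirectSum.
Variable G : nat -> zmodType.

Record dsum : Type := Dsum {
  dsum_fun :> forall n, G n;
  dsum_fin : exists N, forall n, (N <= n)%N -> dsum_fun n = 0 }.

HB.instance Definition _ := gen_eqMixin dsum.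
HB.instance Definition _ := gen_choiceMixin dsum.

Lemma dsum_inj (x y : dsum) : (forall n, x n = y n) -> x = y.
Proof.
case: x y => [x hx] [y hy] /= exy.
have {}exy : x = y by apply: functional_extensionality_dep.
by case: y / exy hy => hy; congr Dsum; apply: Prop_irrelevance.
Qed.

Lemma dsum0_fin : exists N, forall n, (N <= n)%N -> (0 : G n) = 0.
Proof. by exists 0. Qed.
Definition dsum0 := Dsum dsum0_fin.

Lemma dsumN_fin (x : dsum) : exists N, forall n, (N <= n)%N -> - x n = 0.
Proof. by case: (dsum_fin x) => N h; exists N => n /h ->; rewrite oppr0. Qed.
Definition dsumN x := Dsum (dsumN_fin x).

Lemma dsumD_fin (x y : dsum) : exists N, forall n, (N <= n)%N -> x n + y n = 0.
Proof.
case: (dsum_fin x) (dsum_fin y) => N h [N' h']; exists (maxn N N') => n.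
by rewrite geq_max => /andP[/h -> /h' ->]; rewrite addr0.
Qed.
Definition dsumD x y := Dsum (dsumD_fin x y).

Lemma dsum_addA : associative dsumD.
Proof. by move=> x y z; apply: dsum_inj => n /=; rewrite addrA. Qed.
Lemma dsum_addC : commutative dsumD.
Proof. by move=> x y; apply: dsum_inj => n /=; rewrite addrC. Qed.
Lemma dsum_add0 : left_id dsum0 dsumD.
Proof. by move=> x; apply: dsum_inj => n /=; rewrite add0r. Qed.
Lemma dsum_addN : left_inverse dsum0 dsumN dsumD.
Proof. by move=> x; apply: dsum_inj => n /=; rewrite addNr. Qed.

HB.instance Definition _ :=
  GRing.isZmodule.Build dsum dsum_addA dsum_addC dsum_add0 dsum_addN.

Lemma dsum_in_fin n (x : G n) :
  exists N, forall m, (N <= m)%N -> dfwith (fun k => 0 : G k) x m = 0.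
Proof.
exists n.+1 => m lt_nm; rewrite dfwith_out //.
by rewrite neq_ltn lt_nm.
Qed.

Definition dsum_in n (x : G n) : dsum := Dsum (dsum_in_fin x).
End DirectSum.

Record hopf_data (H : zmodType) := HopfData {
  hmul : H -> H -> H;
  hone : H;
  hcomul : H -> tens H H;
  hcounit : H -> int;
  hantipode : H -> H }.

Definition tens_mul (H : zmodType) (mul : H -> H -> H) (s t : tens H H) :
    tens H H :=
  tlift (fun a b => tlift (fun c d => tpure (mul a c) (mul b d)) t) s.

Record is_hopf (H : zmodType) (D : hopf_data H) : Prop := IsHopf {
  hopf_mulD : biadditive (hmul D);
  hopf_mulA : associative (hmul D);
  hopf_mul1l : left_id (hone D) (hmul D);
  hopf_mul1r : right_id (hone D) (hmul D);
  hopf_comulD : zmod_morphism (hcomul D);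
  hopf_comulA : forall x,
    tassoc (tmap (hcomul D) id (hcomul D x)) = tmap id (hcomul D) (hcomul D x);
  hopf_counitD : zmod_morphism (hcounit D);
  hopf_counitl : forall x,
    tlift (fun a b => b *~ hcounit D a) (hcomul D x) = x;
  hopf_counitr : forall x,
    tlift (fun a b => a *~ hcounit D b) (hcomul D x) = x;
  hopf_comulM : forall x y,
    hcomul D (hmul D x y) = tens_mul (hmul D) (hcomul D x) (hcomul D y);
  hopf_comul1 : hcomul D (hone D) = tpure (hone D) (hone D);
  hopf_counitM : forall x y,
    hcounit D (hmul D x y) = hcounit D x * hcounit D y;
  hopf_counit1 : hcounit D (hone D) = 1;
  hopf_antipodeD : zmod_morphism (hantipode D);
  hopf_antipodel : forall x,
    tlift (fun a b => hmul D (hantipode D a) b) (hcomul D x)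
    = hone D *~ hcounit D x;
  hopf_antipoder : forall x,
    tlift (fun a b => hmul D a (hantipode D b)) (hcomul D x)
    = hone D *~ hcounit D x }.

Record is_graded_hopf (H : nat -> zmodType) (D : hopf_data (dsum H)) : Prop :=
  IsGradedHopf {
  ghopf_hopf : is_hopf D;
  ghopf_mul : forall m n (x : H m) (y : H n),
    exists z : H (m + n)%N, hmul D (dsum_in x) (dsum_in y) = dsum_in z;
  ghopf_one : exists z : H 0%N, hone D = dsum_in z;
  ghopf_comul : forall n (x : H n),
    zspan (fun t => exists k l (a : H k) (b : H l),
                      (k + l)%N = n /\ t = tpure (dsum_in a) (dsum_in b))
          (hcomul D (dsum_in x));
  ghopf_counit : forall n (x : H n), (0 < n)%N -> hcounit D (dsum_in x) = 0;
  ghopf_antipode : forall n (x : H n),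
    exists z : H n, hantipode D (dsum_in x) = dsum_in z }.

(* <x (x) y, a (x) b> = <x, a> <y, b>, extended biadditively. *)
Definition tens_pairing (U V : zmodType) (pr : U -> V -> int)
    (s : tens U U) (t : tens V V) : int :=
  tlift (fun x y => tlift (fun a b => pr x a * pr y b) t) s.

(* Perfectness of the pairing in each degree says that each of the two groups
   is the graded dual of the other. *)
Record is_graded_dual (H H' : nat -> zmodType)
    (D : hopf_data (dsum H)) (D' : hopf_data (dsum H'))
    (pr : dsum H -> dsum H' -> int) : Prop := IsGradedDual {
  gdual_biadd : biadditive pr;
  gdual_perfectl : forall n (f : H' n -> int), zmod_morphism f ->
    exists! x : H n, forall y, pr (dsum_in x) (dsum_in y) = f y;
  gdual_perfectr : forall n (f : H n -> int), zmod_morphism f ->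
    exists! y : H' n, forall x, pr (dsum_in x) (dsum_in y) = f x;
  gdual_mul : forall x x' y,
    pr (hmul D x x') y = tens_pairing pr (tpure x x') (hcomul D' y);
  gdual_comul : forall x y y',
    pr x (hmul D' y y') = tens_pairing pr (hcomul D x) (tpure y y');
  gdual_one : forall y, pr (hone D) y = hcounit D' y;
  gdual_counit : forall x, pr x (hone D') = hcounit D x;
  gdual_antipode : forall x y, pr (hantipode D x) y = pr x (hantipode D' y) }.

Definition bilinear_map (K : fieldType) (U V W : lmodType K)
    (f : U -> V -> W) : Prop :=
  (forall u, linear (f u)) /\ (forall v, linear (f^~ v)).

(* Unlike falgType, this allows the zero algebra. *)
Record finAlg (K : fieldType) := FinAlg {
  fa_car :> vectType K;
  fa_mul : fa_car -> fa_car -> fa_car;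
  fa_one : fa_car;
  fa_bilin : bilinear_map fa_mul;
  fa_mulA : associative fa_mul;
  fa_mul1l : left_id fa_one fa_mul;
  fa_mul1r : right_id fa_one fa_mul }.

Arguments fa_mul {K f}.
Arguments fa_one {K f}.

Definition is_alg_hom (K : fieldType) (B B' : finAlg K) (f : B -> B') : Prop :=
  [/\ linear f, f fa_one = fa_one & {morph f : x y / fa_mul x y}].

Section TensorK.
Variable K : fieldType.
Implicit Types U V W : vectType K.

Definition coords V (v : V) : 'rV[K]_(\dim {:V}) := rVof (vbasis {:V}) v.
Definition uncoords V (r : 'rV[K]_(\dim {:V})) : V := vecof (vbasis {:V}) r.

Lemma coords_linear V : linear (@coords V).
Proof. exact: linearP. Qed.
Lemma uncoords_linear V : linear (@uncoords V).
Proof. exact: linearP. Qed.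
Lemma coordsK V : cancel (@coords V) (@uncoords V).
Proof. by apply: rVofK; apply: vbasisP. Qed.
Lemma uncoordsK V : cancel (@uncoords V) (@coords V).
Proof. by apply: vecofK; apply: vbasisP. Qed.

(* A model of the tensor product over K, in coordinates with respect to the
   bases vbasis {:U} and vbasis {:V}. *)
Definition ktens U V : vectType K := 'M[K]_(\dim {:U}, \dim {:V}).

Definition kpure U V (u : U) (v : V) : ktens U V := (coords u)^T *m coords v.

Definition kbase U (i : 'I_(\dim {:U})) : U := (vbasis {:U})`_i.

(* The linear map induced by a bilinear f. *)
Definition klift U V (W : lmodType K) (f : U -> V -> W) (t : ktens U V) : W :=
  \sum_i \sum_j (t : 'M_(_, _)) i j *: f (kbase i) (kbase j).

Lemma kpure_bilin U V : bilinear_map (@kpure U V).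
Proof.
split=> [u c x y|v c x y]; rewrite /kpure coords_linear ?linearP //=.
by rewrite mulmxDl scalemxAl.
Qed.

Lemma kbase_sum U (u : U) : u = \sum_i coords u 0 i *: kbase i.
Proof.
by rewrite -[LHS]coordsK.
Qed.

Lemma klift_linear U V (W : lmodType K) (f : U -> V -> W) : linear (klift f).
Proof.
move=> c s t; rewrite /klift scaler_sumr -big_split; apply: eq_bigr => i _ /=.
rewrite scaler_sumr -big_split; apply: eq_bigr => j _ /=.
by rewrite !mxE scalerDl scalerA.
Qed.

Lemma kliftP U V (W : lmodType K) c (f g : U -> V -> W) t :
  klift (fun u v => c *: f u v + g u v) t = c *: klift f t + klift g t.
Proof.
rewrite /klift scaler_sumr -big_split; apply: eq_bigr => i _ /=.
rewrite scaler_sumr -big_split; apply: eq_bigr => j _ /=.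
by rewrite scalerDr !scalerA mulrC.
Qed.

Lemma linear_sumE (V W : lmodType K) (f : V -> W) : linear f ->
  forall n (c : 'I_n -> K) (F : 'I_n -> V),
    f (\sum_i c i *: F i) = \sum_i c i *: f (F i).
Proof.
move=> lf n c F; pose g := GRing.isLinear.Build _ _ _ _ f lf.
pose h : {linear V -> W} := HB.pack f g.
transitivity (h (\sum_i c i *: F i)) => //; rewrite linear_sum.
by apply: eq_bigr => i _; rewrite linearZ.
Qed.

Lemma kliftE U V (W : lmodType K) (f : U -> V -> W) u v :
  bilinear_map f -> klift f (kpure u v) = f u v.
Proof.
move=> [fr fl]; rewrite [in RHS](kbase_sum u) (linear_sumE (fl v)).
apply: eq_bigr => i _.
rewrite [in RHS](kbase_sum v) (linear_sumE (fr _)) scaler_sumr.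
by apply: eq_bigr => j _; rewrite scalerA !mxE big_ord1 !mxE.
Qed.

Lemma kpure_ext U V (W : lmodType K) (f g : ktens U V -> W) :
  linear f -> linear g -> (forall u v, f (kpure u v) = g (kpure u v)) ->
  forall t, f t = g t.
Proof.
move=> lf lg fg t.
have -> : t = \sum_i \sum_j (t : 'M_(_,_)) i j *: kpure (kbase i) (kbase j).
  rewrite [LHS]matrix_sum_delta; apply: eq_bigr => i _; apply: eq_bigr => j _.
  by rewrite /kpure /kbase /coords !rVofE ?vbasisP// trmx_delta mul_delta_mx.
have E h : linear h -> h (\sum_i \sum_j (t : 'M_(_,_)) i j *:
    kpure (kbase i) (kbase j)) = \sum_i \sum_j (t : 'M_(_,_)) i j *:
    h (kpure (kbase i) (kbase j)) :> W.
  move=> lh.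
  have := linear_sumE lh (fun=> 1).
  move=> /(_ (\dim {:U}) (fun i => \sum_j (t : 'M_(_,_)) i j *: kpure (kbase i) (kbase j))).
  under eq_bigr do rewrite scale1r. move=> ->.
  by apply: eq_bigr => i _; rewrite scale1r (linear_sumE lh).
rewrite !E //; apply: eq_bigr => i _; apply: eq_bigr => j _.
by rewrite fg.
Qed.

(* (u (x) v, x (x) y) |-> f u x (x) g v y, extended bilinearly. *)
Definition kact U V (X X' Y Y' : vectType K) (f : U -> X -> X')
    (g : V -> Y -> Y') (s : ktens U V) (t : ktens X Y) : ktens X' Y' :=
  klift (fun u v => klift (fun x y => kpure (f u x) (g v y)) t) s.

Section Kact.
Variables (U V X X' Y Y' : vectType K).
Variables (f : U -> X -> X') (g : V -> Y -> Y').
Hypotheses (bf : bilinear_map f) (bg : bilinear_map g).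

Lemma kact_inner u v : bilinear_map (fun x y => kpure (f u x) (g v y)).
Proof.
case: (kpure_bilin X' Y') => kr kl.
by split=> [x|y] c a b; rewrite ?bf.1 ?bg.1 ?kr ?kl.
Qed.

Lemma kact_outer t :
  bilinear_map (fun u v => klift (fun x y => kpure (f u x) (g v y)) t).
Proof.
case: (kpure_bilin X' Y') => kr kl.
split=> [u|v] c a b; rewrite -kliftP /klift.
  by apply: eq_bigr => i _; apply: eq_bigr => j _; rewrite bg.2 kr.
by apply: eq_bigr => i _; apply: eq_bigr => j _; rewrite bf.2 kl.
Qed.

Lemma kact_bilin : bilinear_map (kact f g).
Proof.
split=> [s|t]; last exact: klift_linear.
move=> c a b; rewrite /kact -kliftP; congr klift.
by apply/funext => u; apply/funext => v; rewrite klift_linear.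
Qed.

Lemma kactE u v x y :
  kact f g (kpure u v) (kpure x y) = kpure (f u x) (g v y).
Proof.
by rewrite /kact kliftE ?kliftE //; [exact: kact_inner|exact: kact_outer].
Qed.
End Kact.

Section TensorAlgebra.
Variables A B : finAlg K.

Definition ta_mul : ktens A B -> ktens A B -> ktens A B :=
  kact (@fa_mul K A) (@fa_mul K B).
Definition ta_one : ktens A B := kpure fa_one fa_one.

Lemma ta_bilin : bilinear_map ta_mul.
Proof. exact: kact_bilin. Qed.

Lemma ta_mulE a b a' b' :
  ta_mul (kpure a b) (kpure a' b') = kpure (fa_mul a a') (fa_mul b b').
Proof. exact: kactE (fa_bilin A) (fa_bilin B) _ _ _ _. Qed.

Lemma ta_mulA : associative ta_mul.
Proof.
case: ta_bilin => mr ml r s t.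
apply: (kpure_ext (f := fun r => ta_mul r (ta_mul s t))
                  (g := fun r => ta_mul (ta_mul r s) t)).
- exact: ml.
- by move=> c x y; rewrite !ml.
move=> a b.
apply: (kpure_ext (f := fun s => ta_mul (kpure a b) (ta_mul s t))
                  (g := fun s => ta_mul (ta_mul (kpure a b) s) t)).
- by move=> c x y; rewrite ml mr.
- by move=> c x y; rewrite mr ml.
move=> a' b'.
apply: (kpure_ext (f := fun t => ta_mul (kpure a b) (ta_mul (kpure a' b') t))
                  (g := fun t => ta_mul (ta_mul (kpure a b) (kpure a' b')) t)).
- by move=> c x y; rewrite !mr.
- exact: mr.
by move=> a'' b''; rewrite !ta_mulE !fa_mulA.
Qed.

Lemma ta_mul1l : left_id ta_one ta_mul.
Proof.
apply: (kpure_ext (g := id)) => //; first exact: ta_bilin.1.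
by move=> a b; rewrite ta_mulE !fa_mul1l.
Qed.

Lemma ta_mul1r : right_id ta_one ta_mul.
Proof.
apply: (kpure_ext (f := ta_mul^~ ta_one) (g := id)) => //.
  exact: ta_bilin.2.
by move=> a b /=; rewrite ta_mulE !fa_mul1r.
Qed.

Definition tens_alg : finAlg K :=
  FinAlg ta_bilin ta_mulA ta_mul1l ta_mul1r.
End TensorAlgebra.

Section OppositeAlgebra.
Variable A : finAlg K.

Lemma opp_bilin : bilinear_map (fun x y : A => fa_mul y x).
Proof. by split=> a; [exact: (fa_bilin A).2|exact: (fa_bilin A).1]. Qed.
Lemma opp_mulA : associative (fun x y : A => fa_mul y x).
Proof. by move=> x y z; rewrite fa_mulA. Qed.

Definition opp_alg : finAlg K :=
  FinAlg opp_bilin opp_mulA (@fa_mul1r K A) (@fa_mul1l K A).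
End OppositeAlgebra.

Definition is_action (B : finAlg K) (V : lmodType K) (act : B -> V -> V) :=
  [/\ bilinear_map act, forall x, act fa_one x = x
    & forall a b x, act (fa_mul a b) x = act a (act b x)].

Record module (B : finAlg K) := Module {
  mod_car :> lmodType K;
  mod_act : B -> mod_car -> mod_car;
  mod_actP : is_action mod_act }.

(* A finitely generated left module over a finite-dimensional algebra is
   finite-dimensional over K, hence isomorphic to one with underlying space
   some K^d; restricting to the latter makes these modules form a set. *)
Record fgmod (B : finAlg K) := FgMod {
  fg_dim : nat;
  fg_act : B -> 'rV[K]_fg_dim -> 'rV[K]_fg_dim;
  fg_actP : is_action fg_act }.

Coercion fg_module (B : finAlg K) (M : fgmod B) : module B :=
  Module (fg_actP M).

Section FgOf.
Variables (B : finAlg K) (V : vectType K) (act : B -> V -> V).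
Hypothesis actP : is_action act.

Lemma fg_of_actP : is_action (fun b (x : 'rV_(\dim {:V})) =>
  coords (act b (uncoords x))).
Proof.
case: actP => -[ar al] a1 aM; split.
- by split=> [b|x] c y z /=; rewrite ?uncoords_linear ?ar ?al coords_linear.
- by move=> x; rewrite a1 uncoordsK.
- by move=> a b x; rewrite aM coordsK.
Qed.

(* Transport of a module structure on V to K^(\dim {:V}). *)
Definition fg_of : fgmod B := FgMod fg_of_actP.
End FgOf.

Section ModuleTheory.
Variable B : finAlg K.

Definition is_mod_hom (M N : module B) (f : M -> N) : Prop :=
  linear f /\ forall b x, f (mod_act b x) = mod_act b (f x).

Definition surjective (X Y : Type) (f : X -> Y) : Prop :=
  forall y, exists x, f x = y.

Definition projective (P : module B) : Prop :=
  forall (M N : module B) (g : M -> N) (f : P -> N),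
    is_mod_hom g -> surjective g -> is_mod_hom f ->
    exists h : P -> M, is_mod_hom h /\ forall x, g (h x) = f x.

Definition short_exact (L M N : module B) : Prop :=
  exists (f : L -> M) (g : M -> N),
    [/\ is_mod_hom f, is_mod_hom g, injective f, surjective g
      & forall y, g y = 0 <-> exists x, f x = y].

(* Hom_B(M, N) as the subspace of Hom_K(M, N) of the maps commuting with the
   elements of a basis of B. *)
Definition mod_Hom (M N : fgmod B) :
    {vspace 'Hom('rV[K]_(fg_dim M), 'rV[K]_(fg_dim N))} :=
  (\bigcap_i lker (linfun (fun f : 'Hom('rV[K]_(fg_dim M), 'rV[K]_(fg_dim N)) =>
     ((f \o linfun (@fg_act B M (kbase i)))
      - (linfun (@fg_act B N (kbase i)) \o f))%VF)))%VS.

Lemma linfunE (V W : vectType K) (f : V -> W) : linear f -> linfun f =1 f.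
Proof.
move=> lf x; pose h : {linear V -> W} := HB.pack f (GRing.isLinear.Build _ _ _ _ f lf).
exact: (lfunE h).
Qed.

Lemma mod_HomP (M N : fgmod B) (f : 'Hom(_, _)) :
  f \in mod_Hom M N <-> is_mod_hom (M := M) (N := N) f.
Proof.
have [[Mr Ml] _ _] := fg_actP M; have [[Nr Nl] _ _] := fg_actP N.
have lcomm i : linear (fun f : 'Hom('rV[K]_(fg_dim M), 'rV[K]_(fg_dim N)) =>
     ((f \o linfun (@fg_act B M (kbase i)))
      - (linfun (@fg_act B N (kbase i)) \o f))%VF).
  move=> c g h; rewrite comp_lfunDl comp_lfunDr -comp_lfunZl -comp_lfunZr.
  by rewrite scalerBr opprD addrACA.
have memE : f \in mod_Hom M N <->
    forall i x, f (fg_act (kbase i) x) = fg_act (kbase i) (f x).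
  rewrite /mod_Hom memvE; split=> [/subv_bigcapP h i x|h].
    have := h i isT; rewrite -memvE memv_ker linfunE // subr_eq0 => /eqP.
    by move=> /(congr1 (fun g : 'Hom(_, _) => g x)); rewrite !comp_lfunE !linfunE.
  apply/subv_bigcapP => i _; rewrite -memvE memv_ker linfunE // subr_eq0.
  by apply/eqP/lfunP => x; rewrite !comp_lfunE !linfunE.
rewrite memE; split=> [h|[_ h] i x]; last exact: h.
split=> [|b x /=]; first exact: linearP.
rewrite (kbase_sum b) (linear_sumE (Ml x)) (linear_sumE (Nl (f x))) linear_sum.
by apply: eq_bigr => i _; rewrite linearZ; congr (_ *: _); exact: h.
Qed.
End ModuleTheory.

Section ChangeOfRings.
Variables (B B' : finAlg K) (f : B -> B').
Hypothesis fP : is_alg_hom f.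

Lemma res_actP (V : lmodType K) (act : B' -> V -> V) :
  is_action act -> is_action (fun b => act (f b)).
Proof.
case: fP => lf f1 fM [[ar al] a1 aM]; split.
- by split=> [b|x] c y z /=; rewrite ?lf ?ar ?al.
- by move=> x; rewrite f1.
- by move=> a b x; rewrite fM.
Qed.

Definition res (M : fgmod B') : fgmod B := FgMod (res_actP (fg_actP M)).

Lemma reg_actP (A : finAlg K) : is_action (@fa_mul K A).
Proof. by split; [exact: fa_bilin|exact: fa_mul1l|move=> *; rewrite fa_mulA]. Qed.

(* B' as a left B-module: b . a = f b * a. *)
Definition left_mod : module B := Module (res_actP (reg_actP B')).

Lemma right_actP :
  @is_action (opp_alg B) B' (fun b a => fa_mul a (f b)).
Proof.
case: fP => lf f1 fM; have [mr ml] := fa_bilin B'; split.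
- by split=> [b|x] c y z /=; rewrite ?lf ?mr ?ml.
- by move=> x; rewrite f1 fa_mul1r.
- by move=> a b x /=; rewrite fM fa_mulA.
Qed.

(* B' as a right B-module, i.e., a left module over the opposite algebra of B:
   a . b = a * f b. *)
Definition right_mod : module (opp_alg B) := Module right_actP.

Variant bal_rel (M : fgmod B) :
    {freeg (B' * 'rV[K]_(fg_dim M))%type} -> Prop :=
| BalDl a a' x : bal_rel (<< (a + a', x) >> - << (a, x) >> - << (a', x) >>)
| BalDr a x x' : bal_rel (<< (a, x + x') >> - << (a, x) >> - << (a, x') >>)
| BalM a b x : bal_rel (<< (fa_mul a (f b), x) >> - << (a, fg_act b x) >>).

Definition btens (M : fgmod B) : zmodType := pres (@bal_rel M).

Definition bpure (M : fgmod B) (a : B') (x : M) : btens M :=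
  pres_gen (@bal_rel M) (a, x).

(* W is isomorphic to Ind M = B' (x)_B M, on which B' acts by
   a . (a' (x) x) = a a' (x) x. *)
Definition is_ind (M : fgmod B) (W : fgmod B') : Prop :=
  exists phi : btens M -> W,
    [/\ zmod_morphism phi, bijective phi
      & forall a a' x,
          phi (bpure (fa_mul a a') x) = mod_act a (phi (bpure a' x))].
End ChangeOfRings.

Section ExternalTensor.
Variables (A B : finAlg K) (M : fgmod A) (N : fgmod B).

Lemma ext_actP : @is_action (tens_alg A B)
  (ktens 'rV[K]_(fg_dim M) 'rV[K]_(fg_dim N)) (kact (@fg_act A M) (@fg_act B N)).
Proof.
have [Mb M1 MM] := fg_actP M; have [Nb N1 NM] := fg_actP N.
have [ar al] : bilinear_map (kact (@fg_act A M) (@fg_act B N)).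
  exact: kact_bilin.
split=> //.
  apply: (kpure_ext (f := kact _ _ (ta_one A B)) (g := id)) => //.
  by move=> x y; rewrite kactE // M1 N1.
have [mr ml] := ta_bilin A B; move=> s t z.
apply: (kpure_ext (f := fun s => kact _ _ (ta_mul s t) z)
                  (g := fun s => kact _ _ s (kact _ _ t z))).
- by move=> c x y; rewrite ml al.
- exact: al.
move=> a b.
apply: (kpure_ext (f := fun t => kact _ _ (ta_mul (kpure a b) t) z)
                  (g := fun t => kact _ _ (kpure a b) (kact _ _ t z))).
- by move=> c x y; rewrite mr al.
- by move=> c x y; rewrite al ar.
move=> a' b'.
apply: (kpure_ext (f := kact _ _ (ta_mul (kpure a b) (kpure a' b')))
         (g := fun z => kact _ _ (kpure a b) (kact _ _ (kpure a' b') z))).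
- exact: ar.
- by move=> c x y; rewrite !ar.
by move=> x y; rewrite ta_mulE !kactE // MM NM.
Qed.

(* M (x) N, with (a (x) b) . (x (x) y) = a x (x) b y. *)
Definition ext_tens : fgmod (tens_alg A B) := fg_of ext_actP.
End ExternalTensor.

Section Grothendieck.
Variables (B : finAlg K) (Q : fgmod B -> Prop).

Record gobj := GObj { gobj_mod :> fgmod B; gobjP : Q gobj_mod }.
HB.instance Definition _ := gen_eqMixin gobj.
HB.instance Definition _ := gen_choiceMixin gobj.

Variant ses_rel : {freeg gobj} -> Prop :=
| SesRel (L M N : gobj) :
    short_exact L M N -> ses_rel (<< M >> - << L >> - << N >>).

Definition groth : zmodType := pres ses_rel.

(* The class of M. The value 0 when Q M fails is never used below: external
   tensor products of projectives, and their induction and restriction in a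
   tower of algebras, are projective. *)
Definition gcls (M : fgmod B) : groth :=
  if pselect (Q M) is left QM then pres_gen ses_rel (GObj QM) else 0.
End Grothendieck.
End TensorK.

Section Towers.
Variable K : fieldType.

Definition is_graded_unit (A : nat -> finAlg K)
    (rho : forall m n, tens_alg (A m) (A n) -> A (m + n)%N) (e : A 0%N) :=
  forall n (a : A n), rho 0%N n (kpure e a) = a
    /\ ecast i (A i) (addn0 n) (rho n 0%N (kpure a e)) = a.

Record tower := Tower {
  tw :> nat -> finAlg K;
  tw_rho : forall m n, tens_alg (tw m) (tw n) -> tw (m + n)%N;
  tw_assoc : forall m n p (a : tw m) (b : tw n) (c : tw p),
    ecast i (tw i) (addnA m n p)
      (tw_rho (kpure a (tw_rho (kpure b c))))
    = tw_rho (kpure (tw_rho (kpure a b)) c);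
  tw_unit : exists e : tw 0%N, is_graded_unit tw_rho e;
  tw_zero : exists f : tw 0%N -> K^o,
    [/\ linear f, bijective f, f fa_one = 1
      & forall x y, f (fa_mul x y) = f x * f y];
  tw_hom : forall m n, is_alg_hom (@tw_rho m n);
  tw_inj : forall m n, injective (@tw_rho m n);
  tw_projl : forall m n, projective (left_mod (tw_hom m n));
  tw_projr : forall m n, projective (right_mod (tw_hom m n)) }.

Variable A : tower.

Definition tw_rho_at k l n (e : (k + l)%N = n) (t : tens_alg (A k) (A l)) : A n :=
  ecast i (A i) e (tw_rho t).

Lemma tw_rho_atP k l n (e : (k + l)%N = n) : is_alg_hom (tw_rho_at e).
Proof. by case: n / e; apply: tw_hom. Qed.

Section Operations.
(* A class of finitely generated modules over each A_n and A_k (x) A_l. *)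
Variable Q : forall B : finAlg K, fgmod B -> Prop.

Definition grothA (n : nat) : zmodType := groth (@Q (A n)).

Definition clsA n (M : fgmod (A n)) : dsum grothA := dsum_in (gcls (@Q _) M).

Definition is_ind_product (mul : dsum grothA -> dsum grothA -> dsum grothA) :=
  forall m n (M : fgmod (A m)) (N : fgmod (A n)) (W : fgmod (A (m + n)%N)),
    Q M -> Q N -> is_ind (@tw_rho A m n) (ext_tens M N) W ->
    mul (clsA M) (clsA N) = clsA W.

(* The graph of the canonical homomorphism from the tensor product of the
   Grothendieck groups of B and B' to the Grothendieck group of B (x) B',
   [M] (x) [N] |-> [M (x) N]. *)
Definition ext_cls (B B' : finAlg K) (t : tens (groth (@Q B)) (groth (@Q B')))
    (z : groth (@Q (tens_alg B B'))) : Prop :=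
  exists r (c : 'I_r -> int) (M : 'I_r -> fgmod B) (N : 'I_r -> fgmod B'),
    [/\ forall i, Q (M i) /\ Q (N i),
        t = \sum_i tpure (gcls (@Q _) (M i)) (gcls (@Q _) (N i)) *~ c i
      & z = \sum_i gcls (@Q _) (ext_tens (M i) (N i)) *~ c i].

(* Delta [N] is the sum over k + l = n of the [Res N], where the class of Res N
   in the Grothendieck group of A_k (x) A_l is identified with an element
   t k l of the tensor product of those of A_k and A_l. *)
Definition is_res_coproduct
    (comul : dsum grothA -> tens (dsum grothA) (dsum grothA)) :=
  forall n (N : fgmod (A n)), Q N ->
    exists t : forall k l, tens (grothA k) (grothA l),
      (forall k l (e : (k + l)%N = n),
         ext_cls (t k l) (gcls (@Q _) (res (tw_rho_atP e) N)))
      /\ comul (clsA N)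
         = \sum_(k < n.+1) tmap (@dsum_in grothA k) (@dsum_in grothA (n - k)%N)
                             (t k (n - k)%N).
End Operations.

Definition all_mod (B : finAlg K) (M : fgmod B) : Prop := True.
Definition proj_mod (B : finAlg K) (M : fgmod B) : Prop := projective M.

Definition G_gr : nat -> zmodType := grothA all_mod.
Definition K_gr : nat -> zmodType := grothA proj_mod.

Definition is_hom_pairing (pr : dsum K_gr -> dsum G_gr -> int) : Prop :=
  (forall n (P M : fgmod (A n)), projective P ->
     pr (clsA proj_mod P) (clsA all_mod M) = (\dim (mod_Hom P M))%:Z)
  /\ (forall m n (P : fgmod (A m)) (M : fgmod (A n)), projective P -> m != n ->
     pr (clsA proj_mod P) (clsA all_mod M) = 0).

(* The operations on G(A) and K(A) and the pairing are determined by their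
   values on classes of modules. *)
Definition graded_dual_hopf_pair : Prop :=
  exists (DG : hopf_data (dsum G_gr)) (DK : hopf_data (dsum K_gr))
         (pr : dsum K_gr -> dsum G_gr -> int),
    [/\ is_ind_product (hmul DG) /\ is_res_coproduct (hcomul DG),
        is_ind_product (hmul DK) /\ is_res_coproduct (hcomul DK),
        is_hom_pairing pr,
        is_graded_hopf DG /\ is_graded_hopf DK
      & is_graded_dual DK DG pr].
End Towers.

(* Main.v *)
Require Import Defs.
From HB Require Import structures.
From mathcomp Require Import all_boot all_order all_algebra.
From mathcomp Require Import reals complex.
From mathcomp Require Import boolp freeg.

(**
Let [x_n] in [K(A)] and [y_n] in [G(A)] be the classes of the regular module
[A_n], so that [<x_n, y_n> = dim End(A_n) = dim A_n]. Inducing a regular module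
gives a regular module, so [x_n = x_1 ^ n x_0] and [y_n = y_1 ^ n], where [y_0]
is the unit because [A_0] is the ground field. Multiplication by [x_1] on [K(A)]
is adjoint to the operator [d = (<x_1, -> (x) id) Delta] on [G(A)]. As [G(A)] is
connected and [x_1] pairs to zero outside degree 1, [d] is a derivation, with
[d y_1 = <x_1, y_1> 1]; hence [d (y_1 ^ n) = n <x_1, y_1> y_1 ^ (n - 1)], and
[<x_1 ^ n x_0, y_1 ^ n> = n! <x_1, y_1> ^ n <x_0, y_0>].
*)

Set Implicit Arguments.
Unset Strict Implicit.
Unset Printing Implicit Defensive.

Import GRing.Theory Num.Theory.

Local Open Scope ring_scope.
Local Open Scope quotient_scope.

Section ZmodMorphism.
Variables (U V : zmodType) (f : U -> V).
Hypothesis fB : zmod_morphism f.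

Let g : {additive U -> V} := HB.pack f (GRing.isZmodMorphism.Build U V f fB).

Lemma zmod_morphism0 : f 0 = 0.
Proof. exact: (raddf0 g). Qed.

Lemma zmod_morphismD : {morph f : x y / x + y}.
Proof. exact: (raddfD g). Qed.

Lemma zmod_morphismMz n : {morph f : x / x *~ n}.
Proof. exact: (raddfMz g). Qed.
End ZmodMorphism.

Lemma morphD_zmod_morphism (U V : zmodType) (f : U -> V) :
  {morph f : x y / x + y} -> zmod_morphism f.
Proof. by move=> fD x y; apply: (addIr (f y)); rewrite -fD !subrK. Qed.

Section Biadditive.
Variables U V W : zmodType.

Lemma biadditive_comp (U' V' : zmodType) (f : U -> V -> W) (g : U' -> U)
    (h : V' -> V) :
  biadditive f -> zmod_morphism g -> zmod_morphism h ->
  biadditive (fun u v => f (g u) (h v)).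
Proof. by move=> [fr fl] gB hB; split=> ? ? ?; rewrite ?gB ?hB ?fr ?fl. Qed.

Lemma biadditive_postcomp (W' : zmodType) (f : U -> V -> W) (k : W -> W') :
  biadditive f -> zmod_morphism k -> biadditive (fun u v => k (f u v)).
Proof. by move=> [fr fl] kB; split=> ? ? ?; rewrite ?fr ?fl kB. Qed.

Lemma biadditiveD (f g : U -> V -> W) :
  biadditive f -> biadditive g -> biadditive (fun u v => f u v + g u v).
Proof.
by move=> [fr fl] [gr gl]; split=> ? ? ?; rewrite ?fr ?gr ?fl ?gl opprD addrACA.
Qed.

Lemma biadditive_mulrz (phi : U -> int) :
  zmod_morphism phi -> biadditive (fun (v : V) u => v *~ phi u).
Proof. by move=> phiB; split=> ? ? ?; rewrite ?phiB ?mulrzBr ?mulrzBl. Qed.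

Lemma biadditiveC (f : U -> V -> W) :
  biadditive f -> biadditive (fun v u => f u v).
Proof. by case=> fr fl; split. Qed.
End Biadditive.

Lemma mulr_biadditive (R : pzRingType) : biadditive (fun a b : R => a * b).
Proof. by split=> ? ? ?; rewrite ?mulrBr ?mulrBl. Qed.

Lemma freeg_zmod_ind (X : choiceType) (P : {freeg X} -> Prop) :
  P 0 -> (forall y z, P y -> P z -> P (y - z)) -> (forall x, P << x >>) ->
  forall D, P D.
Proof.
move=> P0 PB PU.
have PN y : P y -> P (- y) by move=> /(PB _ _ P0); rewrite sub0r.
have PD y z : P y -> P z -> P (y + z).
  by move=> Py /PN Pz; rewrite -[z]opprK; apply: PB.
apply: freeg_ind_dom0 => // k x D _ _; apply: (PD).
have Pn n : P (<< x >> *+ n).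
  by elim: n => [|n IH]; rewrite ?mulr0n // mulrS; apply: PD.
have -> : << k *g x >> = << x >> *~ k :> {freeg X} by rewrite freegU_mulz intz.
by case: k => n; [apply: Pn|apply: PN; apply: Pn].
Qed.

Section PresTheory.
Variables (X : choiceType) (S : {freeg X} -> Prop).

Lemma pres_pi_rel r : S r -> \pi_(pres S) r = 0.
Proof.
move=> Sr; rewrite -(raddf0 (\pi_(pres S))); apply/eqP.
by rewrite -Quotient.idealrBE subr0 inE; apply/asboolP => P _ _; apply.
Qed.

Lemma pres_genE x y : S (<< x >> - << y >>) -> pres_gen S x = pres_gen S y.
Proof.
by move/pres_pi_rel; rewrite raddfB => /eqP; rewrite subr_eq0 => /eqP.
Qed.

Lemma pres_genD x y z :
  S (<< x >> - << y >> - << z >>) ->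
  pres_gen S x = pres_gen S y + pres_gen S z.
Proof.
move/pres_pi_rel; rewrite !raddfB => /eqP.
by rewrite -addrA -opprD subr_eq0 => /eqP.
Qed.

Lemma pres_ind (P : pres S -> Prop) :
  P 0 -> (forall u v, P u -> P v -> P (u - v)) ->
  (forall x, P (pres_gen S x)) -> forall u, P u.
Proof.
move=> P0 PB PG u; rewrite -[u]reprK.
elim/freeg_zmod_ind: (repr u) => [|D E PD PE|x].
- by rewrite raddf0.
- by rewrite raddfB; apply: PB.
- exact: PG.
Qed.

Lemma pres_ext (W : zmodType) (f g : pres S -> W) :
  zmod_morphism f -> zmod_morphism g ->
  (forall x, f (pres_gen S x) = g (pres_gen S x)) -> f =1 g.
Proof.
move=> fB gB fg; elim/pres_ind => // [|u v fu fv].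
  by rewrite !zmod_morphism0.
by rewrite fB gB fu fv.
Qed.

Lemma pres_liftB (W : zmodType) (f g : X -> W) (u : pres S) :
  pres_lift (fun x => f x - g x) u = pres_lift f u - pres_lift g u.
Proof.
rewrite /pres_lift; elim/freeg_zmod_ind: (repr u) => [|D E ED EE|x].
- by rewrite !(raddf0 (fgext _)) subr0.
- by rewrite !(raddfB (fgext _)) /= ED EE !opprD !opprK addrACA.
- by rewrite !fgextU.
Qed.
End PresTheory.

Section TensTheory.
Variables U V : zmodType.

Lemma tpure_biadditive : biadditive (@tpure U V).
Proof.
by split=> [u|v]; apply: morphD_zmod_morphism => a b; apply: pres_genD;
  [apply: TensDr|apply: TensDl].
Qed.

Lemma tens_ext (W : zmodType) (f g : tens U V -> W) :
  zmod_morphism f -> zmod_morphism g ->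
  (forall u v, f (tpure u v) = g (tpure u v)) -> f =1 g.
Proof. by move=> fB gB fg; apply: pres_ext => // -[u v]; apply: fg. Qed.

Lemma tliftB (W : zmodType) (f g : U -> V -> W) t :
  tlift (fun u v => f u v - g u v) t = tlift f t - tlift g t.
Proof. exact: pres_liftB. Qed.

Lemma eq_tlift (W : zmodType) (f g : U -> V -> W) :
  (forall u v, f u v = g u v) -> tlift f =1 tlift g.
Proof. by move=> fg t; congr tlift; apply/funext => u; apply/funext => v. Qed.

Lemma tlift_biadditive (U' V' W : zmodType) (f : U' -> V' -> U -> V -> W) t :
  (forall u v, biadditive (fun u' v' => f u' v' u v)) ->
  biadditive (fun u' v' => tlift (f u' v') t).
Proof.
move=> fB; split=> [u'|v'] x y; rewrite -tliftB; apply: eq_tlift => u v.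
  exact: (fB u v).1.
exact: (fB u v).2.
Qed.
End TensTheory.

Lemma tens_ext2 (U V U' V' W : zmodType)
    (f g : tens U V -> tens U' V' -> W) :
  biadditive f -> biadditive g ->
  (forall u v u' v',
     f (tpure u v) (tpure u' v') = g (tpure u v) (tpure u' v')) ->
  f =2 g.
Proof.
move=> [fr fl] [gr gl] fg s t.
apply: (tens_ext (fl t) (gl t)) => u v.
exact: tens_ext (fr (tpure u v)) (gr (tpure u v)) (fg u v) t.
Qed.

Section TensMul.
Variables (H : zmodType) (mul : H -> H -> H).
Hypothesis mulD : biadditive mul.

Lemma tens_mul_pure_biadditive a b :
  biadditive (fun c d => tpure (mul a c) (mul b d)).
Proof. exact: biadditive_comp (tpure_biadditive H H) (mulD.1 a) (mulD.1 b). Qed.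

Lemma tens_mul_lift_biadditive t : biadditive
  (fun a b => tlift (fun c d => tpure (mul a c) (mul b d)) t).
Proof.
apply: tlift_biadditive => c d.
exact: biadditive_comp (tpure_biadditive H H) (mulD.2 c) (mulD.2 d).
Qed.

Lemma tens_mul_biadditive : biadditive (tens_mul mul).
Proof.
split=> [s x y|t]; last exact: tlift_additive (tens_mul_lift_biadditive t).
rewrite -tliftB; apply: eq_tlift => a b.
exact: tlift_additive (tens_mul_pure_biadditive a b) _ _.
Qed.

Lemma tens_mulE a b c d :
  tens_mul mul (tpure a b) (tpure c d) = tpure (mul a c) (mul b d).
Proof.
rewrite /tens_mul (tlift_pure (tens_mul_lift_biadditive _)).
exact: tlift_pure (tens_mul_pure_biadditive a b) c d.
Qed.
End TensMul.

Section Contraction.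
Variables U V : zmodType.

Definition contractl (phi : U -> int) (t : tens U V) : V :=
  tlift (fun a b => b *~ phi a) t.

Definition contractr (phi : V -> int) (t : tens U V) : U :=
  tlift (fun a b => a *~ phi b) t.

Lemma contractl_additive phi :
  zmod_morphism phi -> zmod_morphism (contractl phi).
Proof.
by move=> phiB; apply: tlift_additive; apply/biadditiveC/biadditive_mulrz.
Qed.

Lemma contractlE phi a b :
  zmod_morphism phi -> contractl phi (tpure a b) = b *~ phi a.
Proof.
by move=> phiB; apply: tlift_pure; apply/biadditiveC/biadditive_mulrz.
Qed.

Lemma contractr_additive phi :
  zmod_morphism phi -> zmod_morphism (contractr phi).
Proof. by move=> phiB; apply: tlift_additive; apply: biadditive_mulrz. Qed.

Lemma contractrE phi a b :
  zmod_morphism phi -> contractr phi (tpure a b) = a *~ phi b.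
Proof. by move=> phiB; apply: tlift_pure; apply: biadditive_mulrz. Qed.

Lemma contractlr phi psi : zmod_morphism phi -> zmod_morphism psi ->
  forall t, psi (contractl phi t) = phi (contractr psi t).
Proof.
move=> phiB psiB; apply: tens_ext => [s t|s t|a b].
- by rewrite contractl_additive.
- by rewrite contractr_additive.
- rewrite contractlE // contractrE //.
  by rewrite (zmod_morphismMz psiB) (zmod_morphismMz phiB) !mulrzz mulrC.
Qed.
End Contraction.

Section HopfDerivation.
Variables (H : zmodType) (D : hopf_data H).
Hypothesis hopfD : is_hopf D.

Definition counit_derivation (phi : H -> int) : Prop :=
  zmod_morphism phi /\
  forall a b, phi (hmul D a b) = hcounit D a * phi b + phi a * hcounit D b.

Definition hcontract (phi : H -> int) (x : H) : H := contractl phi (hcomul D x).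

Lemma contractl_tens_mul phi : counit_derivation phi -> forall s t,
  contractl phi (tens_mul (hmul D) s t)
  = hmul D (contractl (hcounit D) s) (contractl phi t)
    + hmul D (contractl phi s) (contractl (hcounit D) t).
Proof.
move=> [phiB phiM]; have mulD := hopf_mulD hopfD; have eB := hopf_counitD hopfD.
have lB := contractl_additive (V := H) phiB.
have leB := contractl_additive (V := H) eB.
apply: tens_ext2 => [||a b c d].
- exact: biadditive_postcomp (tens_mul_biadditive mulD) lB.
- exact: biadditiveD (biadditive_comp mulD leB lB)
                      (biadditive_comp mulD lB leB).
rewrite tens_mulE // !contractlE // phiM mulrzDr.
rewrite !(zmod_morphismMz (mulD.1 _)) !(zmod_morphismMz (mulD.2 _)).
by rewrite !mulrzA.
Qed.

Lemma hcontractM phi : counit_derivation phi -> forall x y,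
  hcontract phi (hmul D x y)
  = hmul D x (hcontract phi y) + hmul D (hcontract phi x) y.
Proof.
move=> phiP x y; rewrite /hcontract (hopf_comulM hopfD) contractl_tens_mul //.
by rewrite /(contractl (hcounit D)) !(hopf_counitl hopfD).
Qed.

Lemma derivation_iter_hmul (delta : H -> H) y c :
  (forall a b, delta (hmul D a b) = hmul D a (delta b) + hmul D (delta a) b) ->
  delta y = hone D *~ c ->
  forall n, delta (iter n.+1 (hmul D y) (hone D))
    = iter n (hmul D y) (hone D) *~ (c *+ n.+1).
Proof.
move=> deltaM dy; have [mr ml] := hopf_mulD hopfD.
have [mul1 mulr1] := (hopf_mul1l hopfD, hopf_mul1r hopfD).
have delta1 : delta (hone D) = 0.
  have := deltaM (hone D) (hone D); rewrite !mul1 mulr1 => /eqP.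
  by rewrite -subr_eq0 opprD addrA subrr sub0r oppr_eq0 => /eqP.
have deltaS z : delta (hmul D y z) = hmul D y (delta z) + z *~ c.
  by rewrite deltaM dy (zmod_morphismMz (ml _)) mul1.
elim=> [|n IH]; first by rewrite /= deltaS delta1 (zmod_morphism0 (mr _)) add0r.
rewrite iterS deltaS IH (zmod_morphismMz (mr _)) -iterS.
by rewrite -mulrzDr -mulrSr.
Qed.
End HopfDerivation.

Section Pairing.
Variables (H H' : zmodType) (D : hopf_data H) (D' : hopf_data H').
Variable pr : H' -> H -> int.
Hypotheses (hopfD : is_hopf D) (prD : biadditive pr).
Hypothesis prM : forall x x' u,
  pr (hmul D' x x') u = tens_pairing pr (tpure x x') (hcomul D u).

Lemma pairing_hmul x x' u : pr (hmul D' x x') u = pr x' (hcontract D (pr x) u).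
Proof.
have prB a b := biadditive_comp (mulr_biadditive int) (prD.2 a) (prD.2 b).
have prB' := biadditive_comp (mulr_biadditive int) (prD.1 x) (prD.1 x').
rewrite prM /tens_pairing (tlift_pure (tlift_biadditive _ prB)).
rewrite /hcontract; move: (hcomul D u); apply: tens_ext => [|s t|a b].
- exact: tlift_additive.
- by rewrite (contractl_additive (prD.1 x)) prD.1.
rewrite (contractlE _ _ (prD.1 x)) (zmod_morphismMz (prD.1 x')).
by rewrite (tlift_pure prB') mulrzz mulrC.
Qed.

Lemma pairing_iter_hmul x z y :
  counit_derivation D (pr x) -> hcontract D (pr x) y = hone D *~ pr x y ->
  forall n, pr (iter n (hmul D' x) z) (iter n (hmul D y) (hone D))
    = pr x y ^+ n * pr z (hone D) *+ n`!.
Proof.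
move=> dx dy; elim=> [|n IH]; first by rewrite expr0 mul1r.
rewrite iterS pairing_hmul.
rewrite (derivation_iter_hmul hopfD (hcontractM hopfD dx) dy).
rewrite (zmod_morphismMz (prD.1 _)) IH mulrzz.
by rewrite mulrnAl mulrnAr -mulrnA -factS exprS -mulrA mulrC mulrA.
Qed.
End Pairing.

Section DirectSumTheory.
Variable G : nat -> zmodType.

Lemma dsum_in_additive n : zmod_morphism (@dsum_in G n).
Proof.
move=> x y; apply: dsum_inj => m /=.
have [e|ne] := eqVneq n m; last by rewrite !dfwith_out // subr0.
by case: m / e; rewrite !dfwith_in.
Qed.

Lemma dsum_ind (P : dsum G -> Prop) :
  P 0 -> (forall x y, P x -> P y -> P (x + y)) ->
  (forall n (a : G n), P (dsum_in a)) -> forall x, P x.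
Proof.
move=> P0 PD Pin x; have [N] := dsum_fin x.
elim: N x => [|N IH] x xN.
  by suff -> : x = 0 by []; apply: dsum_inj => n; apply: xN.
rewrite -[x](subrK (dsum_in (x N))); apply: (PD) => //.
apply: IH => n; rewrite leq_eqVlt => /orP[/eqP e|lt_Nn] /=.
  by case: n / e; rewrite dfwith_in subrr.
by rewrite dfwith_out ?subr0 ?xN // ltn_eqF.
Qed.

Lemma dsum_ext (W : zmodType) (f g : dsum G -> W) :
  zmod_morphism f -> zmod_morphism g ->
  (forall n (a : G n), f (dsum_in a) = g (dsum_in a)) -> f =1 g.
Proof.
move=> fB gB fg; elim/dsum_ind => // [|x y fx fy].
  by rewrite !zmod_morphism0.
by rewrite !zmod_morphismD // fx fy.
Qed.
End DirectSumTheory.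

Section ConnectedHopf.
Variables (H : nat -> zmodType) (D : hopf_data (dsum H)).
Hypothesis gradedD : is_graded_hopf D.

Definition hopf_connected : Prop :=
  forall a : H 0, exists k, dsum_in a = hone D *~ k.

Definition concentrated d (phi : dsum H -> int) : Prop :=
  forall n (a : H n), n != d -> phi (dsum_in a) = 0.

Lemma hone_idempotent_gen (e : H 0) :
  hmul D (dsum_in e) (dsum_in e) = dsum_in e ->
  (forall a : H 0, exists k, dsum_in a = dsum_in e *~ k) ->
  hone D = dsum_in e.
Proof.
have hD := ghopf_hopf gradedD; have [one oneE] := ghopf_one gradedD.
move=> ee /(_ one)[k]; rewrite -oneE => oneM.
have := hopf_mul1l hD (dsum_in e).
by rewrite {1}oneM (zmod_morphismMz ((hopf_mulD hD).2 _)) ee -oneM.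
Qed.

Lemma concentrated_counit_derivation phi :
  hopf_connected -> zmod_morphism phi -> concentrated 1 phi ->
  counit_derivation D phi.
Proof.
move=> conn phiB phi1; split=> // x y; have hD := ghopf_hopf gradedD.
have [mr ml] := hopf_mulD hD; have eB := hopf_counitD hD.
have lhsB := biadditive_postcomp (hopf_mulD hD) phiB.
have mulB := mulr_biadditive int.
have rhsB := biadditiveD (biadditive_comp mulB eB phiB)
                         (biadditive_comp mulB phiB eB).
apply: (dsum_ext (lhsB.2 y) (rhsB.2 y)) => m a.
apply: (dsum_ext (lhsB.1 (dsum_in a)) (rhsB.1 (dsum_in a))) => n b.
case: m a => [|m] a; last case: n b => [|n] b.
- rewrite (phi1 _ a) // mul0r addr0; have [k ->] := conn a.
  rewrite (zmod_morphismMz (ml _)) (zmod_morphismMz phiB) (zmod_morphismMz eB).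
  by rewrite (hopf_mul1l hD) (hopf_counit1 hD) intz mulrzz mulrC.
- rewrite (phi1 _ b) // mulr0 add0r; have [k ->] := conn b.
  rewrite (zmod_morphismMz (mr _)) (zmod_morphismMz phiB) (zmod_morphismMz eB).
  by rewrite (hopf_mul1r hD) (hopf_counit1 hD) intz mulrzz.
- have [c ->] := ghopf_mul gradedD a b.
  by rewrite phi1 ?addnS // !(ghopf_counit gradedD) // mul0r mulr0 addr0.
Qed.

(* Only the terms of bidegree (1, 0) of the coproduct of [y] survive, so the
   contraction is a multiple of the unit; the counit tells which one. *)
Lemma hcontract_degree1 phi (y : H 1) :
  hopf_connected -> zmod_morphism phi -> concentrated 1 phi ->
  hcontract D phi (dsum_in y) = hone D *~ phi (dsum_in y).
Proof.
move=> conn phiB phi1; have hD := ghopf_hopf gradedD.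
have lB := contractl_additive (V := dsum H) phiB; have eB := hopf_counitD hD.
have [k dy] : exists k, hcontract D phi (dsum_in y) = hone D *~ k.
  pose scalar t := exists k, contractl phi t = hone D *~ k.
  apply: (ghopf_comul gradedD y (P := scalar)) => [|s t [k sk] [l tl]|t].
  - by exists 0; rewrite (zmod_morphism0 lB).
  - by exists (k - l); rewrite lB sk tl mulrzBr.
  move=> [k [l [a [b [kl ->]]]]]; rewrite /scalar contractlE //.
  case: k l a b kl => [|[|k]] [|l] a b // _.
  - by exists 0; rewrite phi1.
  - by have [c ->] := conn b; exists (c * phi (dsum_in a)); rewrite mulrzA.
have -> // : phi (dsum_in y) = k.
rewrite -{1}[dsum_in y](hopf_counitr hD) -/(contractr (hcounit D) _).
rewrite -contractlr // -/(hcontract D phi _) dy.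
by rewrite (zmod_morphismMz eB) (hopf_counit1 hD) intz.
Qed.
End ConnectedHopf.

Section RegularModule.
Variables (K : fieldType) (B : finAlg K).

Definition reg_module : module B := Module (reg_actP B).

Definition reg_fgmod : fgmod B := fg_of (reg_actP B).

Definition mod_iso (M N : module B) (f : M -> N) : Prop :=
  is_mod_hom f /\ bijective f.

Definition reg_orbit (M : module B) (m : M) (x : reg_fgmod) : M :=
  mod_act (uncoords x : B) m.

Lemma reg_orbit_hom (M : module B) (m : M) : is_mod_hom (reg_orbit m).
Proof.
have [[ar al] a1 aM] := mod_actP M.
split=> [c x y|b x]; first by rewrite /reg_orbit uncoords_linear al.
by rewrite /reg_orbit /= /fg_act /= coordsK aM.
Qed.

Lemma reg_orbit1 (M : module B) (m : M) : reg_orbit m (coords fa_one) = m.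
Proof. by rewrite /reg_orbit coordsK; have [_ -> _] := mod_actP M. Qed.

Lemma reg_hom_orbit (M : module B) (f : reg_fgmod -> M) :
  is_mod_hom f -> f =1 reg_orbit (f (coords fa_one)).
Proof.
move=> [_ fM] x; rewrite /reg_orbit -fM.
by rewrite /= /fg_act /= coordsK fa_mul1r uncoordsK.
Qed.

Lemma projective_reg : projective reg_fgmod.
Proof.
move=> M N g f [_ gM] g_surj f_hom; have [m gm] := g_surj (f (coords fa_one)).
exists (reg_orbit m); split=> [|x]; first exact: reg_orbit_hom.
by rewrite /reg_orbit gM gm -/(reg_orbit _ x) -reg_hom_orbit.
Qed.

Lemma dim_mod_Hom_reg (M : fgmod B) : \dim (mod_Hom reg_fgmod M) = fg_dim M.
Proof.
pose ev (f : 'Hom('rV[K]_(fg_dim reg_fgmod), 'rV[K]_(fg_dim M))) :=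
  f (coords fa_one).
have ev_lin : linear ev by move=> c f g; rewrite /ev add_lfunE scale_lfunE.
have ev_inj : (mod_Hom reg_fgmod M :&: lker (linfun ev) = 0)%VS.
  apply/eqP; rewrite -subv0; apply/subvP => f.
  rewrite memv_cap memv_ker linfunE // memv0 => /andP[/mod_HomP f_hom /eqP f1].
  apply/eqP/lfunP => x; rewrite zero_lfunE (reg_hom_orbit f_hom) -/(ev f) f1.
  have [[ar _] _ _] := mod_actP M.
  exact: zmod_morphism0 (zmod_morphism_linear (ar _)).
have ev_surj : (linfun ev @: mod_Hom reg_fgmod M)%VS = fullv.
  apply/vspaceP => m; rewrite memvf; apply/memv_imgP.
  have [orb_lin orbM] := reg_orbit_hom (m : M).
  exists (linfun (reg_orbit (m : M))).
    by apply/mod_HomP; split=> [|b x]; [exact: linearP|rewrite !linfunE].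
  by rewrite linfunE // /ev linfunE // reg_orbit1.
by rewrite -(limg_dim_eq ev_inj) ev_surj dimvf dim_matrix [LHS]mul1n.
Qed.
End RegularModule.

Section Induction.
Variables (K : fieldType) (B B' : finAlg K) (f : B -> B').
Hypothesis fP : is_alg_hom f.
Variable M : fgmod B.

Definition balanced (W : zmodType) (F : B' -> 'rV[K]_(fg_dim M) -> W) : Prop :=
  biadditive F /\ forall a b x, F (fa_mul a (f b)) x = F a (fg_act b x).

Definition btens_lift (W : zmodType) (F : B' -> 'rV[K]_(fg_dim M) -> W) :
    btens f M -> W :=
  pres_lift (fun p => F p.1 p.2).

Lemma bpure_balanced : balanced (@bpure K B B' f M).
Proof.
split=> [|a b x]; last by apply: pres_genE; apply: BalM.
by split=> [a|x]; apply: morphD_zmod_morphism => y z; apply: pres_genD;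
  [apply: BalDr|apply: BalDl].
Qed.

Section BalancedLift.
Variables (W : zmodType) (F : B' -> 'rV[K]_(fg_dim M) -> W).
Hypothesis F_bal : balanced F.

Lemma fgext_bal_rel r :
  @bal_rel K B B' f M r -> fgext (fun p => F p.1 p.2) r = 0.
Proof.
case: F_bal => -[Fr Fl] FM.
case=> [a b x|a x y|a b x]; rewrite !raddfB /= !fgextU /=.
- by rewrite (zmod_morphismD (Fl x)) addrAC addrK subrr.
- by rewrite (zmod_morphismD (Fr a)) addrAC addrK subrr.
- by rewrite FM subrr.
Qed.

Lemma btens_lift_additive : zmod_morphism (btens_lift F).
Proof. exact: pres_lift_additive fgext_bal_rel. Qed.

Lemma btens_lift_pure a x : btens_lift F (bpure f a x) = F a x.
Proof. exact: pres_lift_gen fgext_bal_rel (a, x). Qed.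
End BalancedLift.

Lemma btens_ext (W : zmodType) (g h : btens f M -> W) :
  zmod_morphism g -> zmod_morphism h ->
  (forall a x, g (bpure f a x) = h (bpure f a x)) -> g =1 h.
Proof. by move=> gB hB gh; apply: pres_ext => // -[a x]; apply: gh. Qed.

Lemma balanced_mul (psi : M -> reg_module B) :
  is_mod_hom psi -> balanced (fun a x => fa_mul a (f (psi x))).
Proof.
move=> [psi_lin psiM]; have [f_lin _ fM] := fP.
have [mr ml] := fa_bilin B'.
split=> [|a b x]; last by rewrite psiM fM fa_mulA.
split=> [a|x] u v; last by rewrite (zmod_morphism_linear (ml _)).
rewrite (zmod_morphism_linear psi_lin) (zmod_morphism_linear f_lin).
exact: zmod_morphism_linear (mr _) _ _.
Qed.

Lemma is_ind_reg (psi : M -> reg_module B) :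
  mod_iso psi -> is_ind f M (reg_fgmod B').
Proof.
move=> [psi_hom [psi' psiK psi'K]]; have [_ f1 _] := fP.
have F_bal := balanced_mul psi_hom; set F := (fun a x => _) in F_bal.
have liftB := btens_lift_additive F_bal.
exists (fun t => coords (btens_lift F t)); split=> [u v||a a' x].
- by rewrite liftB (zmod_morphism_linear (@coords_linear _ B')).
- exists (fun v => bpure f (uncoords v) (psi' fa_one)) => [|v]; last first.
    by rewrite btens_lift_pure // /F psi'K f1 fa_mul1r uncoordsK.
  have [[_ bpl] bpM] := bpure_balanced.
  apply: btens_ext => [u v|//|a x]; rewrite coordsK ?liftB ?bpl ?coordsK //.
  rewrite btens_lift_pure // bpM; congr (bpure f a _); apply: (can_inj psiK).
  by rewrite psi_hom.2 psi'K; apply: fa_mul1r.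
by rewrite !btens_lift_pure //= /fg_act /= coordsK /F fa_mulA.
Qed.
End Induction.

Section TensorMap.
Variable K : fieldType.

Lemma kpure_ext2 (U V X Y : vectType K) (W : lmodType K)
    (f g : ktens U V -> ktens X Y -> W) :
  bilinear_map f -> bilinear_map g ->
  (forall u v x y, f (kpure u v) (kpure x y) = g (kpure u v) (kpure x y)) ->
  f =2 g.
Proof.
move=> [fr fl] [gr gl] fg s t.
apply: (kpure_ext (fl t) (gl t)) => u v.
exact: kpure_ext (fr (kpure u v)) (gr (kpure u v)) (fg u v) t.
Qed.

Definition kmap (U V U' V' : vectType K) (f : U -> U') (g : V -> V') :
    ktens U V -> ktens U' V' :=
  klift (fun u v => kpure (f u) (g v)).

Section KmapTheory.
Variables (U V U' V' : vectType K) (f : U -> U') (g : V -> V').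
Hypotheses (f_lin : linear f) (g_lin : linear g).

Lemma kmap_linear : linear (kmap f g).
Proof. exact: klift_linear. Qed.

Lemma kmapE u v : kmap f g (kpure u v) = kpure (f u) (g v).
Proof.
apply: kliftE; have [kr kl] := kpure_bilin U' V'.
by split=> ? c x y; rewrite ?f_lin ?g_lin ?kr ?kl.
Qed.

Lemma kmap_kact (X Y : vectType K) (actU : X -> U -> U) (actU' : X -> U' -> U')
    (actV : Y -> V -> V) (actV' : Y -> V' -> V') :
  bilinear_map actU -> bilinear_map actU' ->
  bilinear_map actV -> bilinear_map actV' ->
  (forall x u, f (actU x u) = actU' x (f u)) ->
  (forall y v, g (actV y v) = actV' y (g v)) ->
  forall s t, kmap f g (kact actU actV s t) = kact actU' actV' s (kmap f g t).
Proof.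
move=> actUP actUP' actVP actVP' f_act g_act.
have [kr kl] := kact_bilin actU actV; have [kr' kl'] := kact_bilin actU' actV'.
apply: kpure_ext2 => [||x y u v].
- by split=> ? c s t; rewrite ?kr ?kl kmap_linear.
- by split=> ? c s t; rewrite ?kmap_linear ?kr' ?kl'.
- by rewrite kactE // !kmapE kactE // f_act g_act.
Qed.
End KmapTheory.

Lemma kmapK (U V U' V' : vectType K) (f : U -> U') (g : V -> V')
    (f' : U' -> U) (g' : V' -> V) :
  linear f -> linear g -> linear f' -> linear g' ->
  cancel f f' -> cancel g g' -> cancel (kmap f g) (kmap f' g').
Proof.
move=> f_lin g_lin f'_lin g'_lin fK gK.
apply: (kpure_ext (g := id)) => [c s t|//|u v]; first by rewrite !kmap_linear.
by rewrite !kmapE // fK gK.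
Qed.
End TensorMap.

Section ExternalRegular.
Variables (K : fieldType) (A B : finAlg K).

Definition ext_reg_map (x : ext_tens (reg_fgmod A) (reg_fgmod B)) :
    reg_module (tens_alg A B) :=
  kmap (@uncoords K A) (@uncoords K B) (uncoords x).

Lemma ext_reg_map_iso : mod_iso ext_reg_map.
Proof.
have unA := @uncoords_linear K A; have unB := @uncoords_linear K B.
have coA := @coords_linear K A; have coB := @coords_linear K B.
split; first split=> [c x y|s x].
- by rewrite /ext_reg_map uncoords_linear kmap_linear.
- rewrite /ext_reg_map /= coordsK; apply: kmap_kact => //.
  + by have [] := fg_actP (reg_fgmod A).
  + exact: fa_bilin.
  + by have [] := fg_actP (reg_fgmod B).
  + exact: fa_bilin.
  + by move=> a u; rewrite coordsK.
  + by move=> b v; rewrite coordsK.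
exists (fun t => coords (kmap (@coords K A) (@coords K B) t)) => t.
  by rewrite /ext_reg_map kmapK ?uncoordsK // => ?; apply: uncoordsK.
by rewrite /ext_reg_map coordsK kmapK // => ?; apply: coordsK.
Qed.

Lemma is_ind_ext_reg (C : finAlg K) (f : tens_alg A B -> C) :
  is_alg_hom f -> is_ind f (ext_tens (reg_fgmod A) (reg_fgmod B)) (reg_fgmod C).
Proof. by move=> fP; exact: (is_ind_reg fP ext_reg_map_iso). Qed.
End ExternalRegular.

Section GrothendieckTheory.
Variables (K : fieldType) (B : finAlg K) (Q : fgmod B -> Prop).

Lemma gclsE (M : fgmod B) (QM : Q M) :
  gcls Q M = pres_gen (@ses_rel K B Q) (GObj QM).
Proof.
rewrite /gcls; case: pselect => // QM'.
by rewrite (Prop_irrelevance QM QM').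
Qed.

Lemma gcls_ses (L M N : fgmod B) :
  Q L -> Q M -> Q N -> short_exact L M N -> gcls Q M = gcls Q L + gcls Q N.
Proof.
move=> QL QM QN LMN; rewrite !gclsE; apply: pres_genD.
exact: (@SesRel _ _ _ (GObj QL) (GObj QM) (GObj QN)).
Qed.

Lemma groth_ind (P : groth Q -> Prop) :
  P 0 -> (forall u v, P u -> P v -> P (u - v)) ->
  (forall M, Q M -> P (gcls Q M)) -> forall u, P u.
Proof.
by move=> P0 PB PQ; apply: pres_ind => // -[M QM]; rewrite -gclsE; apply: PQ.
Qed.
End GrothendieckTheory.

Section ScalarAlgebra.
Variables (K : fieldType) (B : finAlg K) (f : B -> K^o).
Hypotheses (f_lin : linear f) (f_inj : injective f) (f1 : f fa_one = 1).

Lemma scalar_algE (b : B) : b = (f b : K) *: (fa_one : B).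
Proof.
apply: f_inj; rewrite (scalable_linear f_lin) f1.
by rewrite [RHS]mulr1.
Qed.

Lemma scalar_actE (V : lmodType K) (act : B -> V -> V) :
  is_action act -> forall b x, act b x = (f b : K) *: x.
Proof.
move=> [[_ act_l] act1 _] b x; rewrite {1}(scalar_algE b).
by rewrite (scalable_linear (act_l x)) act1.
Qed.

Lemma scalar_algM : {morph f : x y / fa_mul x y >-> x * y}.
Proof.
by move=> x y; rewrite (scalar_actE (reg_actP B)) (scalable_linear f_lin).
Qed.

Lemma dim_scalar_alg : \dim {:B} = 1%N.
Proof.
have -> : {:B}%VS = <[fa_one]>%VS.
  apply/vspaceP => b; rewrite memvf; apply/esym/vlineP.
  by exists (f b); apply: scalar_algE.
have f0 := zmod_morphism0 (zmod_morphism_linear f_lin).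
rewrite dim_vline; case: eqP => // one0.
by have /eqP := f1; rewrite one0 f0 eq_sym oner_eq0.
Qed.

Lemma scalar_mod_actP d : is_action (fun b (x : 'rV[K]_d) => (f b : K) *: x).
Proof.
split=> [|x|a b x]; last by rewrite scalar_algM scalerA.
- split=> [b|x] c y z /=; first by rewrite scalerDr !scalerA mulrC.
  by rewrite f_lin scalerDl scalerA.
- by rewrite f1 scale1r.
Qed.

Definition scalar_mod d : fgmod B := FgMod (scalar_mod_actP d).

Lemma fgmod_scalar (M : fgmod B) : M = scalar_mod (fg_dim M).
Proof.
case: M => d act actP /=.
have act_scale : act = fun b (x : 'rV[K]_d) => (f b : K) *: x.
  by apply/funext => b; apply/funext => x; apply: scalar_actE actP b x.
rewrite /scalar_mod; move: (scalar_mod_actP d); case: _ / act_scale => actP'.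
by congr FgMod; apply: Prop_irrelevance.
Qed.

Lemma short_exact_scalar_mod d e :
  short_exact (scalar_mod d) (scalar_mod (d + e)) (scalar_mod e).
Proof.
exists (fun x : 'rV[K]_d => row_mx x 0 : 'rV[K]_(d + e)).
exists (fun x : 'rV[K]_(d + e) => rsubmx x); split.
- split=> [c x y|b x] /=.
    by rewrite scale_row_mx add_row_mx scaler0 addr0.
  by rewrite scale_row_mx scaler0.
- by split=> [c x y|b x] /=; [rewrite linearP|rewrite linearZ].
- by move=> x y /eq_row_mx[].
- by move=> y; exists (row_mx 0 y); rewrite row_mxKr.
- move=> y; split=> [y0|[x <-]]; last by rewrite row_mxKr.
  by exists (lsubmx y); rewrite -[RHS]hsubmxK y0.
Qed.

Lemma gcls_scalar_mod d :
  gcls (@all_mod K B) (scalar_mod d) = gcls (@all_mod K B) (scalar_mod 1) *+ d.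
Proof.
pose cls n := gcls (@all_mod K B) (scalar_mod n).
have clsD m n : cls (m + n)%N = cls m + cls n.
  exact: gcls_ses (short_exact_scalar_mod m n).
rewrite -/(cls d) -/(cls 1%N).
elim: d => [|d IH]; last by rewrite -add1n clsD IH mulrS.
by apply: (addrI (cls 0)); rewrite -clsD mulr0n addr0.
Qed.

Lemma groth_scalar_alg (u : groth (@all_mod K B)) :
  exists k, u = gcls (@all_mod K B) (reg_fgmod B) *~ k.
Proof.
elim/groth_ind: u => [|_ _ [k ->] [l ->]|M _].
- by exists 0.
- by exists (k - l); rewrite mulrzBr.
exists (fg_dim M)%:Z.
rewrite [in LHS](fgmod_scalar M) [in RHS](fgmod_scalar (reg_fgmod B)).
by rewrite /= dim_scalar_alg gcls_scalar_mod.
Qed.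
End ScalarAlgebra.

Section TowerRegular.
Variables (K : fieldType) (A : tower K).

Section RegularClasses.
Variable Q : forall B : finAlg K, fgmod B -> Prop.

Definition reg_cls n : dsum (grothA A Q) := clsA Q (reg_fgmod (A n)).

Variable mul : dsum (grothA A Q) -> dsum (grothA A Q) -> dsum (grothA A Q).
Hypothesis mul_ind : is_ind_product mul.
Hypothesis Qreg : forall n, Q (reg_fgmod (A n)).

Lemma reg_clsM m n : mul (reg_cls m) (reg_cls n) = reg_cls (m + n).
Proof. by apply: mul_ind => //; apply: is_ind_ext_reg (tw_hom A m n). Qed.

Lemma reg_cls_iter n : iter n (mul (reg_cls 1)) (reg_cls 0) = reg_cls n.
Proof. by elim: n => // n IH; rewrite iterS IH reg_clsM. Qed.
End RegularClasses.

Lemma dim_tower0 : \dim {:A 0} = 1%N.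
Proof.
have [f [f_lin /bij_inj f_inj f1 _]] := tw_zero A.
exact: dim_scalar_alg f_inj f1.
Qed.

Lemma reg_cls0_gen (a : G_gr A 0) :
  exists k, dsum_in a = reg_cls (@all_mod K) 0 *~ k.
Proof.
have [f [f_lin /bij_inj f_inj f1 _]] := tw_zero A.
have [k ->] := groth_scalar_alg f_lin f_inj f1 a; exists k.
exact: (zmod_morphismMz (@dsum_in_additive _ _)).
Qed.

Lemma hone_reg_cls (D : hopf_data (dsum (G_gr A))) :
  is_graded_hopf D -> is_ind_product (hmul D) ->
  hone D = reg_cls (@all_mod K) 0.
Proof.
move=> gradedD ind; apply: (hone_idempotent_gen gradedD).
  exact: (reg_clsM ind).
exact: reg_cls0_gen.
Qed.

Section HomPairing.
Variable pr : dsum (K_gr A) -> dsum (G_gr A) -> int.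
Hypothesis prP : is_hom_pairing pr.

Lemma pairing_reg_cls n :
  pr (reg_cls (@proj_mod K) n) (reg_cls (@all_mod K) n) = (\dim {:A n})%:R.
Proof. by rewrite prP.1 ?dim_mod_Hom_reg ?natz //; apply: projective_reg. Qed.

Lemma pairing_cls_concentrated n (P : fgmod (A n)) :
  zmod_morphism (pr (clsA (@proj_mod K) P)) -> projective P ->
  concentrated n (pr (clsA (@proj_mod K) P)).
Proof.
move=> prB P_proj m u m_neq_n; have inB := @dsum_in_additive (G_gr A) m.
elim/groth_ind: u => [|u v pu pv|M _].
- by rewrite (zmod_morphism0 inB) (zmod_morphism0 prB).
- by rewrite inB prB pu pv subrr.
- by apply: prP.2; rewrite // eq_sym.
Qed.
End HomPairing.
End TowerRegular.

Theorem theorem1p1 (R : realType) (A : tower R[i]) :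
  graded_dual_hopf_pair A ->
  forall n : nat, (\dim {: A n} = (\dim {: A 1}) ^ n * n`!)%N.
Proof.
move=> [DG [DK [pr [[indG _] [indK _] prP [gradedG _] dual]]]] n.
pose x := reg_cls A (@proj_mod R[i]); pose y := reg_cls A (@all_mod R[i]).
have prB := gdual_biadd dual.
have x1_conc : concentrated 1 (pr (x 1%N)).
  exact: (pairing_cls_concentrated prP (prB.1 _) (@projective_reg _ _)).
have one_y0 : hone DG = y 0%N := hone_reg_cls gradedG indG.
have connG : hopf_connected DG by move=> a; rewrite one_y0; apply: reg_cls0_gen.
have xE : x n = iter n (hmul DK (x 1%N)) (x 0%N).
  by rewrite reg_cls_iter // => m; apply: projective_reg.
have yE : y n = iter n (hmul DG (y 1%N)) (hone DG).
  by rewrite one_y0 reg_cls_iter.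
apply/eqP; rewrite -(eqr_nat int) -(pairing_reg_cls prP) -/(x n) -/(y n) xE yE.
rewrite (pairing_iter_hmul (ghopf_hopf gradedG) prB (gdual_mul dual)).
- rewrite one_y0 !(pairing_reg_cls prP) dim_tower0 mulr1.
  by rewrite natrM natrX mulr_natr.
- exact: (concentrated_counit_derivation gradedG connG (prB.1 _)).
- exact: (hcontract_degree1 gradedG _ connG (prB.1 _)).
Qed.
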